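(* Let $(X,\tau_1,\tau_2)$ be a bitopological space and let $i,j\in\{1,2\}$ with $i\neq j$. Then $(X,\tau_1,\tau_2)$ is $(\tau_i,\tau_j)$-almost Lindelöf if and only if its pairwise semiregularization $(X,\tau^s_{(1,2)},\tau^s_{(2,1)})$ is $(\tau^s_{(i,j)},\tau^s_{(j,i)})$-almost Lindelöf.
   Context: A bitopological space $(X,\tau_1,\tau_2)$ is a set $X$ with two topologies (no separation axioms assumed). For a topology $\sigma$ on $X$, $\sigma\text{-}\mathrm{int}$ and $\sigma\text{-}\mathrm{cl}$ denote interior and closure with respect to $\sigma$. For $i\ne j$ in $\{1,2\}$, a set $S\subseteq X$ is $(\tau_i,\tau_j)$-regular open if $\tau_i\text{-}\mathrm{int}(\tau_j\text{-}\mathrm{cl}(S))=S$. The topology on $X$ generated by the $(\tau_i,\tau_j)$-regular open sets (they are closed under finite intersections and form a base for it) is denoted $\tau^s_{(i,j)}$; the space $(X,\tau^s_{(1,2)},\tau^s_{(2,1)})$ is the pairwise semiregularization of $(X,\tau_1,\tau_2)$. For two topologies $\sigma,\sigma'$ on $X$, the space is $(\sigma,\sigma')$-almost Lindelöf if for every cover $\{U_\alpha:\alpha\in\Delta\}$ of $X$ by $\sigma$-open sets there is a countable subset $\{\alpha_n:n\in\mathbb{N}\}$ of $\Delta$ with $X=\bigcup_{n\in\mathbb{N}}\sigma'\text{-}\mathrm{cl}(U_{\alpha_n})$. *)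

(* Defs.v *)
From HB Require Import structures.
From mathcomp Require Import all_boot all_order all_algebra.
From mathcomp Require Import all_classical topology_structure.

Set Implicit Arguments.
Unset Strict Implicit.
Unset Printing Implicit Defensive.

Local Open Scope classical_set_scope.

(* [Topological X] is the type of topologies on [X]; several of them can live
   on the same carrier, so the operations below take the topology explicitly. *)

Definition open_in (X : Type) (s : Topological X) : set (set X) :=
  @open (Topological.Pack s).

Definition int_in (X : Type) (s : Topological X) (A : set X) : set X :=
  @interior (Topological.Pack s) A.

Definition cl_in (X : Type) (s : Topological X) (A : set X) : set X :=
  @closure (Topological.Pack s) A.

(* The index set {1, 2} is rendered as ['I_2]. *)
Definition bitopology (X : Type) := 'I_2 -> Topological X.

Definition regular_open (X : Type) (s s' : Topological X) (A : set X) : Prop :=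
  int_in s (cl_in s' A) = A.

(* With [s = tau i] and [s' = tau j], the topology put on this copy of [X] is
   tau^s_(i,j). *)
Definition semiregular_space (X : Type) (s s' : Topological X) : Type := X.

Section SemiregularTopology.
Variables (X : Type) (s s' : Topological X).
Local Notation S := (semiregular_space s s').

(* Any choice structure will do: the open sets do not depend on it. *)
HB.instance Definition _ := Choice.copy S (Topological.Pack s).
HB.instance Definition _ :=
  isSubBaseTopological.Build S (regular_open s s' : set (set X)) id.

Definition semiregular_topology : Topological X := Topological.on S.

End SemiregularTopology.

(* [countable] includes finite and empty index sets. *)
Definition almost_lindelof (X : Type) (s s' : Topological X) : Prop :=
  forall (I : Type) (U : I -> set X),
    (forall i, open_in s (U i)) -> \bigcup_i U i = [set: X] ->
    exists D : set I, countable D /\ \bigcup_(i in D) cl_in s' (U i) = [set: X].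

(* Main.v *)
Require Import Defs.
From mathcomp Require Import all_boot finmap all_classical topology_structure.

(** The topology tau^s_(i,j) is coarser than tau_i.  Hence a cover by sets open
    for tau^s_(i,j) is a cover by tau_i-open sets, and closures only grow when
    tau_j is replaced by tau^s_(j,i): this gives the forward implication
    ([semiregular_topology_coarser], [cl_in_anti]).

    For the converse, a cover by tau_i-open sets U is enlarged to the cover by
    the sets tau_i-int (tau_j-cl U), which are open for tau^s_(i,j)
    ([regular_open_int_cl], [open_semiregular]).  Enlarging costs nothing once
    closures are taken: since U is tau_i-open, tau_j-cl U is closed not only
    for tau_j but also for the coarser tau^s_(j,i) ([closed_semiregular_cl]),
    so it contains the tau^s_(j,i)-closure of its subset
    tau_i-int (tau_j-cl U). *)

Local Open Scope classical_set_scope.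

Section TwoTopologies.
Context {X : Type}.
Implicit Types (s t : Topological X) (A U : set X).

Lemma cl_in_anti s t A : open_in t `<=` open_in s -> cl_in s A `<=` cl_in t A.
Proof.
move=> ts; rewrite /cl_in (closureE (T := Topological.Pack s)).
apply: smallest_sub; last exact: (subset_closure (T := Topological.Pack t)).
rewrite -(openC (T := Topological.Pack s)); apply: ts.
apply: (closed_openC (T := Topological.Pack t)).
exact: (closed_closure (T := Topological.Pack t)).
Qed.

Lemma open_semiregular s t A :
  regular_open s t A -> open_in (semiregular_topology s t) A.
Proof.
move=> regA; exists [set A]; last by rewrite bigcup_set1.
move=> _ ->; exists [fset A]%fset; first by move=> B /fset1P->; rewrite inE.
by rewrite set_fset1 bigcap_set1.
Qed.

Lemma semiregular_topology_coarser s t :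
  open_in (semiregular_topology s t) `<=` open_in s.
Proof.
move=> _ [F finF <-].
apply: (bigcup_open (T := Topological.Pack s)) => _ /finF[G regG <-].
rewrite bigcap_fset big_seq; apply: big_ind.
- exact: (openT (T := Topological.Pack s)).
- exact: (openI (T := Topological.Pack s)).
- move=> B /regG; rewrite inE => <-.
  exact: (open_interior (T := Topological.Pack s)).
Qed.

(** As for one topology: the [t]-closure of [int_in s (cl_in t A)] stays
    inside the [t]-closed set [cl_in t A], and an [s]-open set lies in the
    [s]-interior of its [t]-closure.  Nothing relates [s] to [t], so the roles
    can be exchanged, as [closed_semiregular_cl] does. *)
Lemma regular_open_int_cl s t A : regular_open s t (int_in s (cl_in t A)).
Proof.
apply/seteqP; split.
  apply: (interiorS (T := Topological.Pack s)).
  rewrite [X in _ `<=` X](proj1 (closure_id (T := Topological.Pack t) _)).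
    apply: (closureS (T := Topological.Pack t)).
    exact: (interior_subset (T := Topological.Pack s)).
  exact: (closed_closure (T := Topological.Pack t)).
rewrite -(open_subsetE (T := Topological.Pack s)).
  exact: (subset_closure (T := Topological.Pack t)).
exact: (open_interior (T := Topological.Pack s)).
Qed.

(** The complement of the [t]-closure of [U] is the [t]-interior of the
    complement of [U], which is its own [s]-closure; so it has the form
    [int_in t (cl_in s _)] and is [(t, s)]-regular open. *)
Lemma closed_semiregular_cl s t U : open_in s U ->
  @closed (Topological.Pack (semiregular_topology t s)) (cl_in t U).
Proof.
move=> Uop; rewrite -(openC (T := Topological.Pack _)).
rewrite /cl_in -(interiorC (T := Topological.Pack t)).
rewrite (proj1 (closure_id (T := Topological.Pack s) (~` U))).
  exact/open_semiregular/regular_open_int_cl.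
exact: (open_closedC (T := Topological.Pack s)).
Qed.

End TwoTopologies.

Theorem theorem4p4 (X : Type) (tau : bitopology X) (i j : 'I_2) (hij : i != j) :
  almost_lindelof (tau i) (tau j) <->
  almost_lindelof (semiregular_topology (tau i) (tau j))
                  (semiregular_topology (tau j) (tau i)).
Proof.
move: (tau i) (tau j) => s t; split=> lind I U Uop Ucov.
  have [k|D [cD Dcov]] := lind I U _ Ucov.
    exact/semiregular_topology_coarser/Uop.
  exists D; split=> //; apply/seteqP; split=> // x _.
  have [k Dk Ukx] : (\bigcup_(k in D) cl_in t (U k)) x by rewrite Dcov.
  exists k => //; apply: cl_in_anti Ukx.
  exact: semiregular_topology_coarser.
pose V k := int_in s (cl_in t (U k)).
have UV k : U k `<=` V k.
  rewrite -(open_subsetE (T := Topological.Pack s)); last exact: Uop.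
  exact: (subset_closure (T := Topological.Pack t)).
(* [V] keeps the index set of [U], so the countable [D] serves both covers. *)
have [k||D [cD Dcov]] := lind I V.
- exact/open_semiregular/regular_open_int_cl.
- apply/seteqP; split=> // x _.
  have [k _ Ukx] : (\bigcup_k U k) x by rewrite Ucov.
  by exists k => //; apply: UV.
exists D; split=> //; apply/seteqP; split=> // x _.
have [k Dk Vkx] :
    (\bigcup_(k in D) cl_in (semiregular_topology t s) (V k)) x.
  by rewrite Dcov.
exists k => //.
(* As [cl_in t (U k)] is its own semiregular closure, [V k] being inside it
   suffices. *)
rewrite (proj1 (closure_id (T := Topological.Pack (semiregular_topology t s))
  (cl_in t (U k))) (closed_semiregular_cl _ _ _ (Uop k))).
apply: closureS Vkx.
exact: (interior_subset (T := Topological.Pack s)).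
Qed.
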